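(* Let $f=\frac1n\sum_{i=1}^n f_i$ be an $L$-smooth, $\mu$-strongly convex quadratic finite sum as described in the context, with $n\ge2$, $\kappa=L/\mu>1$ and minimizer $w^*$. Let $$T\ge\bar T:=\frac{3\cdot2^8\sqrt\kappa}{\ln 2}\max\{4\kappa,e^2\},$$ and run the Multi-stage SHB algorithm described in the context with iteration budget $T$ and batch-size $$b\ge b^*:=n\,\max\left\{\frac{1}{1+\frac{n-1}{C\kappa^2}},\ \frac{1}{1+\frac{(n-1)a_I}{3}}\right\},\qquad C:=3^52^6,\quad a_I=2^{-I}.$$ Then its output, denoted $w_T$, satisfies $$\mathbb{E}\|w_T-w^*\|\le C_7\exp\left(-\frac{T}{8\sqrt\kappa}\right)\|w_0-w^*\|+C_8\,\frac{\chi}{\sqrt T},$$ where $\chi:=\sqrt{\frac1n\sum_{i=1}^n\|\nabla f_i(w^* )\|^2}$ and $C_7=C_7(\kappa,T)$, $C_8=C_8(\kappa,T)$ are polynomial in $\kappa$ and poly-logarithmic in $T$ ($C_8$ may also depend on $\mu$).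
   Context: Setting: $f_i(w)=\frac12 w^TA_iw-\langle d_i,w\rangle$ on $\mathbb{R}^d$ with $A_i$ symmetric positive semi-definite and each $f_i$ bounded below; $f=\frac1n\sum_i f_i=\frac12 w^TAw-\langle d,w\rangle$ with $A=\frac1n\sum_iA_i$, $d=\frac1n\sum_i d_i$. Each $f_i$ is $L$-smooth with $L=\max_i\lambda_{\max}(A_i)$, and $\mu=\lambda_{\min}(A)>0$. In every iteration a mini-batch $B\subseteq\{1,\dots,n\}$ of size $b$ is sampled uniformly without replacement, independently across iterations; the corresponding stochastic gradient at $x$ is $\frac1b\sum_{i\in B}\nabla f_i(x)$. $\mathbb{E}$ is over all mini-batches; $\|\cdot\|$ is the Euclidean norm. Multi-stage SHB algorithm (input $T$, $b$, $w_0$): let $\mathcal W$ be the Lambert W function ($y=\mathcal W(x)$ means $ye^y=x$) and $$I=\left\lfloor\frac{1}{\ln\sqrt2}\,\mathcal W\!\left(\frac{T\ln\sqrt2}{384\sqrt\kappa}\right)\right\rfloor,\quad T_0=\frac T2,\quad T_i=\left\lceil\frac{4\cdot2^{i/2}\sqrt\kappa}{2-\sqrt2}\Big((i/2+5)\ln2+\ln\sqrt\kappa\Big)\right\rceil\ (1\le i\le I).$$ For stages $i=0,1,\dots,I$: set $a_i=2^{-i}$, $\alpha_i=a_i/L$, $\beta_i=\left(1-\frac12\sqrt{\alpha_i\mu}\right)^2$; start from $x_0=x_{-1}=w_i$; for each integer $k$ with $0\le k<T_i$, sample a fresh mini-batch, let $g_k$ be the stochastic gradient at $x_k$, and set $x_{k+1}=x_k-\alpha_ig_k+\beta_i(x_k-x_{k-1})$;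 let $w_{i+1}$ be the last iterate of the stage. The output is $w_{I+1}$. *)

(* Defs.v *)
From HB Require Import structures.
From mathcomp Require Import all_boot all_order all_algebra.
From mathcomp Require Import all_classical all_reals all_analysis.

Set Implicit Arguments.
Unset Strict Implicit.
Unset Printing Implicit Defensive.

Import Order.TTheory GRing.Theory Num.Theory.
Import numFieldNormedType.Exports.

Local Open Scope ring_scope.

Definition dotv (R : realType) (d : nat) (u v : 'cV[R]_d) : R :=
  (u^T *m v) ord0 ord0.

(* The norm `|v| that MathComp-Analysis puts on matrices is the sup norm. *)
Definition enorm (R : realType) (d : nat) (v : 'cV[R]_d) : R :=
  Num.sqrt (dotv v v).

Definition symmetric_psd (R : realType) (d : nat) (M : 'M[R]_d) : Prop :=
  M^T = M /\ forall x : 'cV[R]_d, 0 <= dotv x (M *m x).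

(* [eigenvalue] is about left eigenvectors, i.e. eigenvectors of M^T, which is
   immaterial for symmetric M. For symmetric M and d > 0 the set is finite and
   nonempty, so the sup and the inf are attained; for d = 0 both are 0. *)
Definition lambda_max (R : realType) (d : nat) (M : 'M[R]_d) : R :=
  sup [set a | eigenvalue M a]%classic.

Definition lambda_min (R : realType) (d : nat) (M : 'M[R]_d) : R :=
  inf [set a | eigenvalue M a]%classic.

Definition quad (R : realType) (d : nat) (M : 'M[R]_d) (c w : 'cV[R]_d) : R :=
  2^-1 * dotv w (M *m w) - dotv c w.

Definition grad (R : realType) (d : nat) (f : 'cV[R]_d -> R) (x : 'cV[R]_d) :
    'cV[R]_d :=
  \col_j 'D_(delta_mx j ord0) f x.

Definition mean (R : realType) (V : lmodType R) (n : nat) (F : 'I_n -> V) : V :=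
  n%:R^-1 *: \sum_(i < n) F i.

Definition finite_sum (R : realType) (d n : nat) (f : 'I_n -> 'cV[R]_d -> R)
    (w : 'cV[R]_d) : R :=
  n%:R^-1 * \sum_(i < n) f i w.

(* The base value 0 of the maximum is harmless: the matrices are positive
   semi-definite. *)
Definition smoothness (R : realType) (d n : nat) (A : 'I_n -> 'M[R]_d) : R :=
  \big[Num.max/0]_(i < n) lambda_max (A i).

Definition strong_convexity (R : realType) (d n : nat) (A : 'I_n -> 'M[R]_d) :
    R :=
  lambda_min (mean A).

Definition grad_noise (R : realType) (d n : nat) (f : 'I_n -> 'cV[R]_d -> R)
    (w : 'cV[R]_d) : R :=
  Num.sqrt (n%:R^-1 * \sum_(i < n) enorm (grad (f i) w) ^+ 2).

Definition stoch_grad (R : realType) (d n : nat) (f : 'I_n -> 'cV[R]_d -> R)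
    (b : nat) (B : {set 'I_n}) (x : 'cV[R]_d) : 'cV[R]_d :=
  b%:R^-1 *: \sum_(i in B) grad (f i) x.

(* Some solution y of y * exp y = x; it exists and is unique when 0 <= x, the
   only case of interest here. *)
Definition lambertW (R : realType) (x : R) : R :=
  xget 0 [set y : R | y * expR y = x]%classic.

Definition last_stage (R : realType) (kappa : R) (T : nat) : nat :=
  Num.truncn ((ln (Num.sqrt 2))^-1 *
    lambertW (T%:R * ln (Num.sqrt 2) / (384 * Num.sqrt kappa))).

(* T_i, which need not be an integer for i = 0. *)
Definition stage_budget (R : realType) (kappa : R) (T i : nat) : R :=
  if i == 0%N then T%:R / 2
  else (Num.ceil (4 * 2 `^ (i%:R / 2) * Num.sqrt kappa / (2 - Num.sqrt 2) *
          ((i%:R / 2 + 5) * ln 2 + ln (Num.sqrt kappa))))%:~R.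

(* The number of integers k with 0 <= k < T_i. *)
Definition stage_length (R : realType) (kappa : R) (T i : nat) : nat :=
  `|Num.ceil (stage_budget kappa T i)|%N.

Definition batch_offset (R : realType) (kappa : R) (T i : nat) : nat :=
  (\sum_(j < i) stage_length kappa T j)%N.

Definition stage_scale (R : realType) (i : nat) : R := 2 ^- i.

(* The pair (x_k, x_(k-1)) after k heavy-ball steps from x_0 = x_(-1) = w;
   G k is the stochastic gradient oracle of step k. *)
Fixpoint shb (R : realType) (d : nat) (alpha beta : R)
    (G : nat -> 'cV[R]_d -> 'cV[R]_d) (w : 'cV[R]_d) (k : nat) :
    'cV[R]_d * 'cV[R]_d :=
  if k is k'.+1 then
    let: (x, xprev) := shb alpha beta G w k' in
    (x - alpha *: G k' x + beta *: (x - xprev), x)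
  else (w, w).

(* The point w_i at which stage i starts. The mini-batches of all stages are
   listed consecutively in Bs. *)
Fixpoint multistage_shb (R : realType) (d n : nat) (f : 'I_n -> 'cV[R]_d -> R)
    (L mu : R) (T b : nat) (w0 : 'cV[R]_d) (Bs : seq {set 'I_n}) (i : nat) :
    'cV[R]_d :=
  if i is i'.+1 then
    let kappa := L / mu in
    let alpha := stage_scale R i' / L in
    let beta := (1 - 2^-1 * Num.sqrt (alpha * mu)) ^+ 2 in
    let G k := stoch_grad f b (nth finset.set0 Bs (batch_offset kappa T i' + k)) in
    (shb alpha beta G (multistage_shb f L mu T b w0 Bs i')
         (stage_length kappa T i')).1
  else w0.

(* Sampling N times independently, uniformly among the subsets of 'I_n of
   cardinal b, amounts to the uniform distribution on this set. *)
Definition batch_seqs (n b N : nat) : {set N.-tuple {set 'I_n}} :=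
  [set Bs : N.-tuple {set 'I_n} | all (fun B : {set 'I_n} => #|B| == b) Bs].

Definition uniform_expectation (R : realType) (S : finType) (D : {set S})
    (X : S -> R) : R :=
  #|D|%:R^-1 * \sum_(s in D) X s.

Definition shb_output_error (R : realType) (d n : nat)
    (f : 'I_n -> 'cV[R]_d -> R) (L mu : R) (T b : nat) (w0 wstar : 'cV[R]_d) :
    R :=
  let stages := (last_stage (L / mu) T).+1 in
  uniform_expectation (batch_seqs n b (batch_offset (L / mu) T stages))
    (fun Bs => enorm (multistage_shb f L mu T b w0 Bs stages - wstar)).

Definition min_budget (R : realType) (kappa : R) : R :=
  3 * 2 ^+ 8 * Num.sqrt kappa / ln 2 * Num.max (4 * kappa) (expR 1 ^+ 2).

Definition min_batch (R : realType) (n : nat) (kappa : R) (T : nat) : R :=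
  let C : R := 3 ^+ 5 * 2 ^+ 6 in
  n%:R * Num.max (1 / (1 + (n%:R - 1) / (C * kappa ^+ 2)))
           (1 / (1 + (n%:R - 1) * stage_scale R (last_stage kappa T) / 3)).

(* At most polynomial growth of degree p in kappa, and poly-logarithmic growth
   of degree q in t. *)
Definition poly_polylog (R : realType) (p q : nat) (C : R -> R -> R) : Prop :=
  exists K : R, forall kappa t : R, 1 < kappa -> 1 <= t ->
    `|C kappa t| <= K * kappa ^+ p * (1 + ln t) ^+ q.

(* Main.v *)
Require Import Defs.
From mathcomp Require Import all_boot all_order all_fingroup all_algebra.
From mathcomp Require Import all_classical all_reals all_analysis.
From mathcomp Require Import ring lra.

(* Write [a] for the scale of a stage, so that its step size is [alpha = a / L],
   and [s = sqrt (a / kappa)]. In error coordinates the noiseless heavy-ball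
   recursion reads [y_(k+1) + rho^2 y_(k-1) = 2 rho M y_k] with
   [rho = 1 - s / 2] and a symmetric matrix [M] such that
   [0 <= M <= 1 - s^2 / 4]; it multiplies the quadratic form
   [|u|^2 + |v|^2 - 2 <u, M v>] at [u = y_k], [v = rho y_(k-1)] by exactly
   [rho^2]. An additive perturbation [e] increases the square root of this form
   by at most [|e|], and the form dominates [(s^2 / 4) |u|^2], so no spectral
   decomposition is needed.

   Sampling without replacement produces noise of expected norm at most
   [zeta (L |u| + chi)] with [zeta^2 = (n - b) / (b (n - 1))]. The first bound on
   the batch size gives [100 kappa zeta <= 1], hence a contraction by
   [1 - s / 4] per step in expectation, and a stage of length [K] maps an
   expected error [E] to at most [(4 / s) (1 - s / 4)^K E + 8 zeta chi / mu].
   The first stage accounts for [exp (- T / (8 sqrt kappa))], the later ones have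
   a factor at most 1. The second bound on the batch size gives
   [zeta <= sqrt a_I], which is [O (sqrt kappa log T / T)] by the definition of
   [I] through the Lambert function; this beats the number of stages, which is
   [O (log T)]. *)

Set Implicit Arguments.
Unset Strict Implicit.
Unset Printing Implicit Defensive.

Import Order.TTheory GRing.Theory Num.Theory.
Import numFieldNormedType.Exports.

Local Open Scope ring_scope.

(** * The Euclidean inner product *)

Section InnerProduct.
Variables (R : realType) (d : nat).
Implicit Types (u v w x y : 'cV[R]_d) (M Q : 'M[R]_d) (a t : R).

Lemma dotvE u v : dotv u v = \sum_i u i ord0 * v i ord0.
Proof. by rewrite /dotv mxE; apply: eq_bigr => i _; rewrite mxE. Qed.

Lemma dotvC u v : dotv u v = dotv v u.
Proof. by rewrite !dotvE; apply: eq_bigr => i _; rewrite mulrC. Qed.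

Lemma dotvDl u v w : dotv (u + v) w = dotv u w + dotv v w.
Proof. by rewrite /dotv linearD mulmxDl mxE. Qed.

Lemma dotvZl a u v : dotv (a *: u) v = a * dotv u v.
Proof. by rewrite /dotv linearZ -scalemxAl mxE. Qed.

Lemma dotvNl u v : dotv (- u) v = - dotv u v.
Proof. by rewrite -scaleN1r dotvZl mulN1r. Qed.

Lemma dotvDr u v w : dotv u (v + w) = dotv u v + dotv u w.
Proof. by rewrite dotvC dotvDl !(dotvC _ u). Qed.

Lemma dotvZr a u v : dotv u (a *: v) = a * dotv u v.
Proof. by rewrite dotvC dotvZl dotvC. Qed.

Lemma dotvNr u v : dotv u (- v) = - dotv u v.
Proof. by rewrite dotvC dotvNl dotvC. Qed.

Lemma dotv0 u : dotv u 0 = 0.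
Proof. by rewrite /dotv mulmx0 mxE. Qed.

Lemma dotv_suml (I : finType) (P : pred I) (F : I -> 'cV[R]_d) v :
  dotv (\sum_(i | P i) F i) v = \sum_(i | P i) dotv (F i) v.
Proof.
rewrite (big_morph (fun u => dotv u v) (id1 := 0) (op1 := +%R)) // => [u w|].
  exact: dotvDl.
by rewrite dotvC dotv0.
Qed.

Lemma dotv_sumr (I : finType) (P : pred I) (F : I -> 'cV[R]_d) v :
  dotv v (\sum_(i | P i) F i) = \sum_(i | P i) dotv v (F i).
Proof. by rewrite dotvC dotv_suml; apply: eq_bigr => i _; rewrite dotvC. Qed.

Definition dotv_linear := (dotvDl, dotvDr, dotvNl, dotvNr, dotvZl, dotvZr).

Lemma dotv_mulmx u M v : dotv u (M *m v) = dotv (M^T *m u) v.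
Proof. by rewrite /dotv trmx_mul trmxK mulmxA. Qed.

Lemma dotv_ge0 u : 0 <= dotv u u.
Proof. by rewrite dotvE; apply: sumr_ge0 => i _; rewrite -expr2 sqr_ge0. Qed.

Lemma dotv_eq0 u : (dotv u u == 0) = (u == 0).
Proof.
rewrite dotvE psumr_eq0; last by move=> i _; rewrite -expr2 sqr_ge0.
apply/allP/eqP => [u0|-> i _]; last by rewrite /= mxE mul0r eqxx.
apply/colP => i; rewrite mxE; apply/eqP.
by have /= := u0 i (mem_index_enum i); rewrite mulf_eq0 orbb.
Qed.

Lemma psd_form_sym Q u v : symmetric_psd Q -> dotv u (Q *m v) = dotv v (Q *m u).
Proof. by move=> [QT _]; rewrite dotv_mulmx QT dotvC. Qed.

(** The form of [Q] at [x + t y] is a polynomial in [t] of degree at most 2 that is nowhere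
    negative. *)
Lemma psd_cauchy_schwarz Q x y : symmetric_psd Q ->
  dotv x (Q *m y) ^+ 2 <= dotv x (Q *m x) * dotv y (Q *m y).
Proof.
move=> psdQ; have [_ Q_ge0] := psdQ.
set a := dotv x (Q *m x); set b := dotv x (Q *m y); set c := dotv y (Q *m y).
have pos t : 0 <= a + 2 * t * b + t ^+ 2 * c.
  have := Q_ge0 (x + t *: y).
  rewrite mulmxDr -scalemxAr !dotv_linear (psd_form_sym y x psdQ) -/a -/b -/c.
  by congr (_ <= _); ring.
have c_ge0 : 0 <= c by apply: Q_ge0.
move: c_ge0; rewrite le_eqVlt => /predU1P[c0|c_gt0].
  rewrite -c0 mulr0; have [->|b0] := eqVneq b 0; first by rewrite expr0n.
  (* When [c = 0] the polynomial is affine; this [t] would give it the value -1. *)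
  have := pos (- (a + 1) / (2 * b)); rewrite -c0 mulr0 addr0.
  rewrite [X in _ <= X](_ : _ = -1) ?ler0N1 //; by field.
(* The minimizer of the polynomial. *)
have := pos (- b / c).
rewrite [X in _ <= X](_ : _ = (a * c - b ^+ 2) / c); last by field; rewrite gt_eqF.
by rewrite pmulr_lge0 ?invr_gt0// subr_ge0.
Qed.

Lemma symmetric_psd1 : symmetric_psd (1%:M : 'M[R]_d).
Proof. by split=> [|x]; rewrite ?trmx1 // mul1mx dotv_ge0. Qed.

Lemma enorm_ge0 u : 0 <= enorm u.
Proof. exact: sqrtr_ge0. Qed.

Lemma sqr_enorm u : enorm u ^+ 2 = dotv u u.
Proof. by rewrite sqr_sqrtr // dotv_ge0. Qed.

Lemma dotv_le_enorm u v : dotv u v <= enorm u * enorm v.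
Proof.
apply: le_trans (ler_norm _) _.
rewrite -ler_sqr ?nnegrE ?mulr_ge0 ?enorm_ge0// real_normK ?num_real//.
rewrite exprMn !sqr_enorm.
by have := psd_cauchy_schwarz u v symmetric_psd1; rewrite !mul1mx.
Qed.

Lemma enormD u v : enorm (u + v) <= enorm u + enorm v.
Proof.
rewrite -ler_sqr ?nnegrE ?addr_ge0 ?enorm_ge0// sqrrD !sqr_enorm.
rewrite !dotv_linear (dotvC v u).
by have := dotv_le_enorm u v; lra.
Qed.

Lemma enormZ a u : enorm (a *: u) = `|a| * enorm u.
Proof.
by rewrite /enorm !dotv_linear mulrA -expr2 sqrtrM ?sqr_ge0// sqrtr_sqr.
Qed.

(** Cauchy-Schwarz for the form of [Q] at [x] and [Q x] bounds [|Q x|^4] by [<x, Q x> * a |Q x|^2];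
    then divide by [|Q x|^2]. *)
Lemma sqr_psd_mulmx_le Q a x : symmetric_psd Q ->
  (forall y, dotv y (Q *m y) <= a * dotv y y) ->
  dotv (Q *m x) (Q *m x) <= a * dotv x (Q *m x).
Proof.
move=> psdQ Qa; have [QT Q_ge0] := psdQ.
have [Qx0|Qx_neq0] := eqVneq (dotv (Q *m x) (Q *m x)) 0.
  have /eqP -> : Q *m x == 0 by rewrite -dotv_eq0 Qx0.
  by rewrite !dotv0 mulr0.
have Qx_gt0 : 0 < dotv (Q *m x) (Q *m x) by rewrite lt_def Qx_neq0 dotv_ge0.
have := psd_cauchy_schwarz x (Q *m x) psdQ.
rewrite dotv_mulmx QT expr2 => /le_trans /(_ (ler_wpM2l (Q_ge0 x) (Qa _))).
by rewrite mulrA ler_pM2r// mulrC.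
Qed.

End InnerProduct.

(** * Extreme eigenvalues and quadratic forms *)

Section Rayleigh.
Variables (R : realType) (d : nat).
Implicit Types (u v w x y : 'cV[R]_d) (M Q : 'M[R]_d) (a s : R).

Lemma mulmx_bounded M : exists2 K : R, 0 < K &
  forall x, dotv (M *m x) (M *m x) <= K * dotv x x.
Proof.
pose r i : 'cV[R]_d := (row i M)^T.
have r_ge0 : 0 <= \sum_i dotv (r i) (r i) by apply: sumr_ge0 => i _; exact: dotv_ge0.
(* The squared Frobenius norm, increased by 1 to be positive even for [M = 0]. *)
exists (1 + \sum_i dotv (r i) (r i)) => [|x]; first by rewrite ltr_pwDl.
rewrite mulrDl mul1r; apply: le_trans (_ : (\sum_i dotv (r i) (r i)) * dotv x x <= _).
  rewrite mulr_suml (dotvE (M *m x)); apply: ler_sum => i _.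
  rewrite (_ : (M *m x) i ord0 = dotv (r i) x).
    by have := psd_cauchy_schwarz (r i) x (symmetric_psd1 R d); rewrite !mul1mx.
  by rewrite mxE dotvE; apply: eq_bigr => j _; rewrite !mxE.
by rewrite lerDr dotv_ge0.
Qed.

Lemma quadratic_form_bounded M : exists2 K : R, 0 < K &
  forall x, dotv x (M *m x) <= K * dotv x x.
Proof.
have [K K_gt0 MK] := mulmx_bounded M; exists (1 + K) => [|x]; first by rewrite addr_gt0.
have := dotv_ge0 (x - M *m x); have := MK x; have := dotv_ge0 x.
have := dotv_ge0 (M *m x).
rewrite !dotv_linear (dotvC (M *m x) x); lra.
Qed.

(* With [s] the supremum of the Rayleigh quotient, [s - M] is positive
   semi-definite; if it were invertible it would even be coercive, so that
   a smaller bound than [s] would hold. *)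
Lemma eigenvalue_rayleigh_sup M : (0 < d)%N -> M^T = M ->
  exists2 s, eigenvalue M s & forall x, dotv x (M *m x) <= s * dotv x x.
Proof.
move=> d_gt0 MT.
pose S : set R :=
  [set a | exists2 x, x != 0 & a = dotv x (M *m x) / dotv x x]%classic.
have sqn_gt0 x : x != 0 -> 0 < dotv x x.
  by move=> x0; rewrite lt_def dotv_eq0 x0 dotv_ge0.
have ubS a : (forall x, dotv x (M *m x) <= a * dotv x x) -> ubound S a.
  by move=> aP _ [x x0 ->]; rewrite ler_pdivrMr ?sqn_gt0.
have [K K_gt0 MK] := quadratic_form_bounded M.
have S_ub : has_ubound S by exists K; exact: ubS.
have S_neq0 : (S !=set0)%classic.
  pose x : 'cV[R]_d := const_mx 1.
  exists (dotv x (M *m x) / dotv x x), x => //.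
  by apply/eqP => /colP /(_ (Ordinal d_gt0)); rewrite !mxE => /eqP; rewrite oner_eq0.
set s := sup S.
have sP x : dotv x (M *m x) <= s * dotv x x.
  have [->|x0] := eqVneq x 0; first by rewrite mulmx0 !dotv0 mulr0.
  rewrite -ler_pdivrMr ?sqn_gt0 //; apply: ub_le_sup => //.
  by exists x.
exists s => //; apply: contraT => sNeig.
pose Q := s%:M - M.
have QE x : dotv x (Q *m x) = s * dotv x x - dotv x (M *m x).
  by rewrite mulmxBl mul_scalar_mx !dotv_linear.
have psdQ : symmetric_psd Q.
  split=> [|x]; first by rewrite linearB /= tr_scalar_mx MT.
  by rewrite QE subr_ge0.
have Q_unit : Q \in unitmx.
  rewrite -row_free_unit -kermx_eq0; apply: contraNT sNeig => kerQ.
  rewrite /eigenvalue /eigenspace -opprB -/Q.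
  apply: contra kerQ => /eqP kerNQ; rewrite -submx0 -kerNQ.
  by apply/sub_kermxP; rewrite mulmxN mulmx_ker oppr0.
have [K1 K1_gt0 K1P] := mulmx_bounded (invmx Q).
have [K2 K2_gt0 K2P] := quadratic_form_bounded Q.
(* Coercivity constant: [|x|^2 <= K1 |Q x|^2 <= K1 K2 <x, Q x>]. *)
pose c := (K1 * K2)^-1.
have c_gt0 : 0 < c by rewrite invr_gt0 mulr_gt0.
have : s <= s - c.
  apply: ge_sup => //; apply: ubS => x.
  rewrite mulrBl lerBrDr -lerBrDl -QE /c mulrC ler_pdivrMr ?mulr_gt0 // mulrC.
  rewrite -{1}(mulKmx Q_unit x) -{2}(mulKmx Q_unit x) -mulrA.
  apply: le_trans (K1P _) _; rewrite ler_pM2l //.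
  exact: sqr_psd_mulmx_le.
by rewrite lerBrDl gerDr leNgt c_gt0.
Qed.

Lemma eigenvalue_le M a s : M^T = M ->
  (forall x, dotv x (M *m x) <= s * dotv x x) -> eigenvalue M a -> a <= s.
Proof.
move=> MT sP /eigenvalueP[v vM v0].
have v0' : 0 < dotv v^T v^T.
  by rewrite lt_def dotv_eq0 dotv_ge0 andbT -trmx0 (inj_eq trmx_inj).
have := sP v^T; rewrite dotv_mulmx -trmx_mul vM linearZ dotvZl.
by rewrite ler_pM2r.
Qed.

Lemma lambda_max_rayleigh M x : M^T = M ->
  dotv x (M *m x) <= lambda_max M * dotv x x.
Proof.
move=> MT; have [d0|d_gt0] := posnP d.
  have -> : x = 0 by apply/colP => i; have := ltn_ord i; rewrite [X in (_ < X)%N]d0.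
  by rewrite mulmx0 !dotv0 mulr0.
have [s s_eig sP] := eigenvalue_rayleigh_sup d_gt0 MT.
apply: le_trans (sP x) _; apply: ler_wpM2r; first exact: dotv_ge0.
by apply: ub_le_sup => //; exists s => a; exact: eigenvalue_le.
Qed.

(** The supremum argument is applied to [- M], whose eigenvalues are the opposites of those of
    [M]. *)
Lemma lambda_min_rayleigh M x : M^T = M ->
  lambda_min M * dotv x x <= dotv x (M *m x).
Proof.
move=> MT; have [d0|d_gt0] := posnP d.
  have -> : x = 0 by apply/colP => i; have := ltn_ord i; rewrite [X in (_ < X)%N]d0.
  by rewrite mulmx0 !dotv0 mulr0.
have MTN : (- M)^T = - M by rewrite linearN /= MT.
have [s s_eig sP] := eigenvalue_rayleigh_sup d_gt0 MTN.
have eigN a : eigenvalue M a -> eigenvalue (- M) (- a).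
  move=> /eigenvalueP[v vM v0]; apply/eigenvalueP; exists v => //.
  by rewrite mulmxN vM scaleNr.
have eigs : eigenvalue M (- s).
  move/eigenvalueP: s_eig => [v vM v0]; apply/eigenvalueP; exists v => //.
  by rewrite scaleNr -vM mulmxN opprK.
have := sP x; rewrite mulNmx dotvNr => sPx.
apply: le_trans (_ : - s * dotv x x <= _); last by rewrite mulNr lerNl.
apply: ler_wpM2r; first exact: dotv_ge0.
apply: ge_inf => //.
by exists (- s) => a /eigN; rewrite lerNl; exact: eigenvalue_le.
Qed.

End Rayleigh.

(** * Gradients and minimizers of quadratics *)

Section Gradient.
Variables (R : realType) (d : nat).
Implicit Types (u v w x y c : 'cV[R]_d) (M : 'M[R]_d) (t : R).

Lemma quad_addZ M c x v t : M^T = M ->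
  quad M c (x + t *: v) =
    quad M c x + t * dotv v (M *m x - c) + t ^+ 2 * (2^-1 * dotv v (M *m v)).
Proof.
move=> MT; rewrite /quad mulmxDr -scalemxAr !dotv_linear.
by rewrite (dotv_mulmx x M v) MT (dotvC (M *m x) v) (dotvC v c); field.
Qed.

Lemma derive_quad M c x v : M^T = M ->
  'D_v (quad M c) x = dotv v (M *m x - c).
Proof.
move=> MT; apply/cvg_lim => //.
pose q := 2^-1 * dotv v (M *m v).
(* For [h != 0] the difference quotient of a quadratic is exactly this affine function of [h]. *)
have lin : ((dotv v (M *m x - c) + h * q) @[h --> 0^'] -->
    dotv v (M *m x - c) + 0 * q)%classic.
  apply: cvg_within_filter; apply: cvgD; first exact: cvg_cst.
  by apply: cvgMl; exact: cvg_id.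
rewrite mul0r addr0 in lin; apply: cvg_trans lin.
apply: near_eq_cvg; near=> h.
have h0 : h != 0 by near: h; exact: nbhs_dnbhs_neq.
rewrite /= [h *: v + x]addrC quad_addZ // /q /GRing.scale /=; field.
Unshelve. all: by end_near.
Qed.

Lemma grad_quad M c x : M^T = M -> grad (quad M c) x = M *m x - c.
Proof.
move=> MT; apply/colP => j; rewrite mxE derive_quad // dotvE (bigD1 j) //=.
rewrite big1 => [|i ij]; last by rewrite mxE eqxx andbT (negPf ij) mul0r.
by rewrite [delta_mx _ _ _ _]mxE !eqxx mul1r addr0.
Qed.

Lemma quad_min_grad M c x : M^T = M -> (forall y, quad M c x <= quad M c y) ->
  M *m x - c = 0.
Proof.
move=> MT x_min; set g := M *m x - c.
set q := 2^-1 * dotv g (M *m g).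
have pos t : 0 <= t * dotv g g + t ^+ 2 * q.
  have := x_min (x + t *: g); rewrite quad_addZ // -/g -/q.
  by rewrite -addrA lerDl.
have q_ge0 : 0 <= q by have := pos 1; have := pos (-1); lra.
apply/eqP; rewrite -dotv_eq0 eq_le dotv_ge0 andbT.
set a := dotv g g in pos *.
(* Near the minimizing [t]; the denominator [q + 1] stays positive when [q = 0], and the value is
   exactly [- (a / (q + 1))^2]. *)
have := pos (- (a / (q + 1))).
rewrite (_ : _ + _ = - (a / (q + 1)) ^+ 2); last by field; rewrite gt_eqF // ltr_wpDl.
rewrite oppr_ge0 => a0; have : a / (q + 1) == 0.
  by rewrite -sqrf_eq0 eq_le a0 sqr_ge0.
rewrite mulf_eq0 invr_eq0 (gt_eqF (_ : 0 < q + 1)) ?ltr_wpDl // orbF => /eqP ->.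
exact: lexx.
Qed.

End Gradient.

(** * Sampling without replacement *)

Definition draws (n b : nat) : {set {set 'I_n}} := [set B : {set 'I_n} | #|B| == b].

Lemma card_draws_gt0 n b : (b <= n)%N -> (0 < #|draws n b|)%N.
Proof. by move=> bn; rewrite card_draws card_ord bin_gt0. Qed.

Section Sampling.
Variables (R : realType) (n b : nat).
Implicit Types (i j : 'I_n) (s : {perm 'I_n}).

Definition pair_count i j : R :=
  \sum_(B in draws n b) ((i \in B) && (j \in B))%:R.

(** Relabelling the indices permutes the draws, so a pair count can only depend on whether the two
    indices coincide. *)
Lemma pair_count_perm s i j : pair_count (s i) (s j) = pair_count i j.
Proof.
rewrite /pair_count (reindex_inj (imset_inj (@perm_inj _ s))) /=.
apply: eq_big => [B|B _]; first by rewrite !inE card_imset //; exact: perm_inj.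
by rewrite !(mem_imset _ _ (@perm_inj _ s)).
Qed.

Lemma pair_count_diag i i' : pair_count i i = pair_count i' i'.
Proof. by rewrite -(pair_count_perm (tperm i i') i i) tpermL. Qed.

(** One transposition takes [i] to [i']; a second one takes the image of [j] to [j'] and fixes
    [i']. *)
Lemma pair_count_offdiag i j i' j' : i != j -> i' != j' ->
  pair_count i j = pair_count i' j'.
Proof.
move=> ij ij'; rewrite -(pair_count_perm (tperm i i')) tpermL.
set k := tperm i i' j; rewrite -(pair_count_perm (tperm k j')) tpermL.
rewrite tpermD // 1?eq_sym // -(tpermL i i') /k (inj_eq perm_inj) eq_sym //.
by rewrite eq_sym.
Qed.

Lemma sum_mem_draw (B : {set 'I_n}) : B \in draws n b ->
  \sum_i (i \in B)%:R = b%:R :> R.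
Proof.
rewrite inE => /eqP <-; rewrite -sum1_card natr_sum [RHS]big_mkcond /=.
by apply: eq_bigr => i _; case: (i \in B).
Qed.

Lemma sum_pair_count_diag : \sum_i pair_count i i = b%:R * #|draws n b|%:R.
Proof.
rewrite exchange_big /= (eq_bigr (fun=> b%:R)) => [|B Bb].
  by rewrite sumr_const mulr_natr.
by rewrite -(sum_mem_draw Bb); apply: eq_bigr => i _; rewrite andbb.
Qed.

(** Double counting: every draw that contains [i] contains [b] indices [j]. *)
Lemma sum_pair_count i : \sum_j pair_count i j = b%:R * pair_count i i.
Proof.
rewrite exchange_big /= mulr_sumr; apply: eq_bigr => B Bb.
rewrite -(sum_mem_draw Bb) mulr_suml; apply: eq_bigr => j _.
by rewrite andbb andbC; case: (_ \in _); case: (_ \in _); rewrite ?mulr0 ?mulr1.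
Qed.

(** The variance formula for sampling without replacement, with denominators cleared. Pair counts
    equal [p] on the diagonal and [q] off it; centering removes the constant part [q], leaving
    [p - q], which the relations [np] and [nq] determine. *)
Lemma sum_sqr_draw d (y : 'I_n -> 'cV[R]_d) : (2 <= n)%N -> \sum_i y i = 0 ->
  n%:R * (n%:R - 1) *
    (\sum_(B in draws n b) dotv (\sum_(i in B) y i) (\sum_(i in B) y i)) =
  #|draws n b|%:R * b%:R * (n%:R - b%:R) * \sum_i dotv (y i) (y i).
Proof.
move=> n_ge2 sum_y0.
pose i0 : 'I_n := Ordinal (ltnW n_ge2); pose i1 : 'I_n := Ordinal n_ge2.
set p := pair_count i0 i0; set q := pair_count i0 i1.
have countE i j : pair_count i j = q + (p - q) * (i == j)%:R.
  have [<-|ij] := eqVneq; first by rewrite (pair_count_diag i i0) -/p mulr1; ring.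
  by rewrite (@pair_count_offdiag _ _ i0 i1) // -/q mulr0 addr0.
have np : n%:R * p = b%:R * #|draws n b|%:R.
  rewrite -sum_pair_count_diag (eq_bigr (fun=> p)) => [|i _].
    by rewrite sumr_const card_ord mulr_natl.
  exact: pair_count_diag.
have nq : (n%:R - 1) * q + p = b%:R * p.
  rewrite -sum_pair_count (eq_bigr _ (fun j _ => countE i0 j)) big_split /=.
  rewrite sumr_const card_ord -mulr_natl -mulr_sumr (bigD1 i0) //= big1.
    by rewrite addr0 mulr1; ring.
  by move=> i; rewrite eq_sym => /negPf ->.
have -> : \sum_(B in draws n b) dotv (\sum_(i in B) y i) (\sum_(i in B) y i) =
    (p - q) * \sum_i dotv (y i) (y i).
  transitivity (\sum_i \sum_j pair_count i j * dotv (y i) (y j)).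
    under [RHS]eq_bigr do under eq_bigr do rewrite mulr_suml.
    under [RHS]eq_bigr do rewrite exchange_big.
    rewrite [RHS]exchange_big /=; apply: eq_bigr => B _.
    rewrite dotv_suml big_mkcond /=; apply: eq_bigr => i _.
    case: (i \in B) => /=; last by rewrite big1 // => j _; rewrite mul0r.
    rewrite dotv_sumr big_mkcond /=; apply: eq_bigr => j _.
    by case: (j \in B); rewrite ?mul1r ?mul0r.
  rewrite mulr_sumr; transitivity
    (\sum_i (q * dotv (y i) (\sum_j y j) + (p - q) * dotv (y i) (y i))); last first.
    by apply: eq_bigr => i _; rewrite sum_y0 dotv0 mulr0 add0r.
  apply: eq_bigr => i _; rewrite dotv_sumr mulr_sumr.
  under eq_bigr do rewrite countE mulrDl.
  rewrite big_split /=; congr (_ + _).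
  rewrite (bigD1 i) //= eqxx mulr1 big1 ?addr0 // => j.
  by rewrite eq_sym => /negPf ->; rewrite mulr0 mul0r.
rewrite [LHS]mulrA; congr (_ * _).
have -> : n%:R * (n%:R - 1) * (p - q) =
   (n%:R * p) * (n%:R - b%:R) - n%:R * ((n%:R - 1) * q + p - b%:R * p) by ring.
by rewrite np nq; ring.
Qed.

End Sampling.

(** * The heavy-ball Lyapunov function *)

Section HeavyBall.
Variables (R : realType) (d : nat) (A : 'M[R]_d) (alpha s : R).
Hypotheses (s_gt0 : 0 < s) (s_le1 : s <= 1) (AT : A^T = A).
Hypothesis A_ge : forall x, s ^+ 2 * dotv x x <= alpha * dotv x (A *m x).
Hypothesis A_le : forall x, alpha * dotv x (A *m x) <= dotv x x.
Implicit Types (u v w x e : 'cV[R]_d).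

(* Here [s ^+ 2] is the strong convexity constant of [alpha * f]. With [u] the
   current and [v] the previous error, a noiseless heavy-ball step maps
   [(u, rho v)] to [rho *: (2 (1 - P) u - rho v, u)]. *)
Let rho : R := 1 - 2^-1 * s.
Let P : 'M[R]_d := (2 * rho)^-1 *: (alpha *: A - (s ^+ 2 / 4)%:M).

Let rho_ge : 2^-1 <= rho. Proof. by move: s_le1; rewrite /rho; lra. Qed.
Let rho_le : rho <= 1. Proof. by move: s_gt0; rewrite /rho; lra. Qed.

Let PE x : P *m x = (2 * rho)^-1 *: (alpha *: (A *m x) - (s ^+ 2 / 4) *: x).
Proof. by rewrite -scalemxAl mulmxBl -scalemxAl mul_scalar_mx. Qed.

Let P_form x : 2 * rho * dotv x (P *m x) =
  alpha * dotv x (A *m x) - s ^+ 2 / 4 * dotv x x.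
Proof.
by rewrite PE !dotv_linear mulVKf // mulf_neq0 ?gt_eqF //; have := rho_ge; lra.
Qed.

Let P_ge x : s ^+ 2 / 4 * dotv x x <= dotv x (P *m x).
Proof.
have rho2 : 0 < 2 * rho by have := rho_ge; lra.
rewrite -(ler_pM2l rho2) P_form.
set Y := s ^+ 2 * dotv x x; have Y_ge0 : 0 <= Y by rewrite mulr_ge0 ?dotv_ge0 ?sqr_ge0.
have := A_ge x; have : rho * Y <= Y by rewrite ler_piMl.
rewrite -/Y (_ : 2 * rho * _ = 2^-1 * (rho * Y)); last by rewrite /Y; field.
by rewrite mulrAC -/Y; lra.
Qed.

Let P_le x : dotv x (P *m x) <= 1 * dotv x x.
Proof.
have rho2 : 0 < 2 * rho by have := rho_ge; lra.
rewrite -(ler_pM2l rho2) P_form; have := A_le x.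
(* The slack [2 rho - (1 - s^2 / 4)] is exactly [rho^2]. *)
have : 0 <= rho ^+ 2 * dotv x x by rewrite mulr_ge0 ?dotv_ge0 ?sqr_ge0.
rewrite /rho; nra.
Qed.

Let P_psd : symmetric_psd P.
Proof.
split=> [|x]; first by rewrite linearZ linearB linearZ /= AT tr_scalar_mx.
by apply: le_trans (P_ge x); rewrite mulr_ge0 ?divr_ge0 ?sqr_ge0 ?dotv_ge0.
Qed.

(** The quadratic form [|u|^2 + |v|^2 - 2 <u, M v>] with [M = 1 - P]; it is invariant under
    [(u, v) -> (2 M u - v, u)]. *)
Definition lyap u v : R :=
  dotv u u + dotv v v - 2 * (dotv u v - dotv u (P *m v)).

Lemma lyap_completed_square u v :
  lyap u v = dotv (u - (v - P *m v)) (u - (v - P *m v)) +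
    (2 * dotv v (P *m v) - dotv (P *m v) (P *m v)).
Proof.
rewrite /lyap !dotv_linear.
by rewrite (dotvC v u) (dotvC (P *m v) u) (dotvC (P *m v) v); ring.
Qed.

Lemma lyapC u v : lyap u v = lyap v u.
Proof. by rewrite /lyap (psd_form_sym u v P_psd) (dotvC u v); ring. Qed.

(** Since [0 <= P <= 1], one has [P^2 <= P], so the remainder [2 P - P^2] of the completed square is
    at least [P]. *)
Lemma lyap_ge u v :
  dotv (u - (v - P *m v)) (u - (v - P *m v)) + dotv v (P *m v) <= lyap u v.
Proof.
by rewrite lyap_completed_square; have := sqr_psd_mulmx_le v P_psd P_le; lra.
Qed.

Lemma sqr_le_lyap u v : s ^+ 2 / 4 * dotv u u <= lyap u v.
Proof.
rewrite lyapC; apply: le_trans (lyap_ge v u); apply: le_trans (P_ge u) _.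
by rewrite lerDr dotv_ge0.
Qed.

Lemma lyap_ge0 u v : 0 <= lyap u v.
Proof.
apply: le_trans (sqr_le_lyap u v).
by rewrite mulr_ge0 ?divr_ge0 ?sqr_ge0 ?dotv_ge0.
Qed.

(** Takes the current and the previous error; the rescaling by [rho] turns the damped recursion into
    [rho] times an isometry of [lyap]. *)
Definition hb_norm u v : R := Num.sqrt (lyap u (rho *: v)).

Lemma enorm_le_hb_norm u v : enorm u <= 2 / s * hb_norm u v.
Proof.
rewrite -ler_sqr ?nnegrE ?mulr_ge0 ?enorm_ge0 ?sqrtr_ge0 ?invr_ge0 ?(ltW s_gt0) //.
rewrite sqr_enorm exprMn sqr_sqrtr ?lyap_ge0 //.
have /(ler_wpM2l (sqr_ge0 (2 / s))) := sqr_le_lyap u (rho *: v).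
by congr (_ <= _); field; rewrite gt_eqF.
Qed.

Lemma hb_norm_init u : hb_norm u u <= 2 * enorm u.
Proof.
rewrite -ler_sqr ?nnegrE ?mulr_ge0 ?enorm_ge0 ?sqrtr_ge0 //.
rewrite exprMn sqr_enorm sqr_sqrtr ?lyap_ge0 // /lyap -scalemxAr !dotv_linear.
have : rho * dotv u (P *m u) <= rho * (1 * dotv u u).
  by rewrite ler_wpM2l // (le_trans _ rho_ge).
have : 0 <= (1 - rho ^+ 2) * dotv u u.
  by rewrite mulr_ge0 ?dotv_ge0 ?subr_ge0 ?expr_le1 // (le_trans _ rho_ge).
by have := dotv_ge0 u; nra.
Qed.

(** In its first argument [lyap] is quadratic with leading part [|e|^2] and linear part [2 <z, e>],
    and [|z|] is at most its square root. *)
Lemma sqrt_lyapD e u v :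
  Num.sqrt (lyap (u + e) v) <= Num.sqrt (lyap u v) + enorm e.
Proof.
rewrite -ler_sqr ?nnegrE ?addr_ge0 ?enorm_ge0 ?sqrtr_ge0 //.
rewrite sqrrD sqr_enorm !sqr_sqrtr ?lyap_ge0 //.
set z := u - (v - P *m v).
have -> : lyap (u + e) v = lyap u v + 2 * dotv z e + dotv e e.
  rewrite /lyap /z !dotv_linear.
  by rewrite (dotvC e u) (dotvC e v) (dotvC e (P *m v)); ring.
have : enorm z <= Num.sqrt (lyap u v).
  rewrite ler_wsqrtr //; apply: le_trans (lyap_ge u v); rewrite lerDl.
  by have [_] := P_psd.
move=> /(ler_wpM2r (enorm_ge0 e)); have := dotv_le_enorm z e; lra.
Qed.

Lemma hb_norm_step u v e :
  hb_norm (u - alpha *: (A *m u) + rho ^+ 2 *: (u - v) + e) u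
    <= rho * hb_norm u v + enorm e.
Proof.
apply: le_trans (sqrt_lyapD _ _ _) _; rewrite lerD2r.
have rho_ge0 : 0 <= rho by apply: le_trans rho_ge.
rewrite /hb_norm.
have -> (a : R) : rho * Num.sqrt a = Num.sqrt (rho ^+ 2 * a).
  by rewrite sqrtrM ?sqr_ge0 // sqrtr_sqr ger0_norm.
rewrite ler_wsqrtr //.
(* The coefficients of [u] match because [1 + rho^2 - s^2 / 4 = 2 rho]. *)
have -> : u - alpha *: (A *m u) + rho ^+ 2 *: (u - v) =
    rho *: (2 *: (u - P *m u) - rho *: v).
  have -> : alpha *: (A *m u) = (2 * rho) *: (P *m u) + (s ^+ 2 / 4) *: u.
    rewrite PE scalerA mulfV ?scale1r ?subrK // mulf_neq0 // gt_eqF //.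
    exact: lt_le_trans rho_ge.
  by rewrite /rho; apply/colP => i; rewrite !mxE; field.
rewrite /lyap -!scalemxAr !dotv_linear.
rewrite (psd_form_sym v u P_psd) (dotvC v u) (dotvC (P *m u) u) (dotvC (P *m u) v).
rewrite (psd_form_sym v u P_psd); lra.
Qed.

End HeavyBall.

(** * Uniform expectations and the noise of a single draw *)

Section UniformExpectation.
Variables (R : realType) (S : finType) (D : {set S}).
Implicit Types (X Y : S -> R) (a : R).

Lemma uniform_expectation_le X Y : (forall s, s \in D -> X s <= Y s) ->
  uniform_expectation D X <= uniform_expectation D Y.
Proof.
by move=> XY; rewrite ler_wpM2l ?invr_ge0 // ler_sum.
Qed.

Lemma uniform_expectation_ge0 X : (forall s, 0 <= X s) ->
  0 <= uniform_expectation D X.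
Proof. by move=> X0; rewrite mulr_ge0 ?invr_ge0 // sumr_ge0. Qed.

Lemma uniform_expectationD X Y :
  uniform_expectation D (fun s => X s + Y s) =
  uniform_expectation D X + uniform_expectation D Y.
Proof. by rewrite /uniform_expectation big_split mulrDr. Qed.

Lemma uniform_expectationZ a X :
  uniform_expectation D (fun s => a * X s) = a * uniform_expectation D X.
Proof. by rewrite /uniform_expectation -mulr_sumr mulrCA. Qed.

Lemma uniform_expectation_cst a : (0 < #|D|)%N ->
  uniform_expectation D (fun=> a) = a.
Proof.
move=> D_gt0; rewrite /uniform_expectation sumr_const -[a *+ _]mulr_natl mulKf //.
by rewrite pnatr_eq0 -lt0n.
Qed.

Lemma uniform_expectation_sqr X : (0 < #|D|)%N ->
  uniform_expectation D X ^+ 2 <= uniform_expectation D (fun s => X s ^+ 2).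
Proof.
move=> D_gt0; set m := uniform_expectation D X.
have : 0 <= uniform_expectation D (fun s => (X s - m) ^+ 2).
  by apply: uniform_expectation_ge0 => s; exact: sqr_ge0.
have -> : uniform_expectation D (fun s => (X s - m) ^+ 2) =
    uniform_expectation D (fun s => X s ^+ 2 + (- 2 * m * X s + m ^+ 2)).
  by congr (_ * _); apply: eq_bigr => s _; ring.
rewrite !uniform_expectationD uniform_expectationZ uniform_expectation_cst //.
rewrite -/m; nra.
Qed.

End UniformExpectation.

(* [draw_factor n b ^+ 2] is the finite-population variance factor of sampling
   without replacement. *)
Definition draw_factor (R : realType) (n b : nat) : R :=
  Num.sqrt ((n%:R - b%:R) / (b%:R * (n%:R - 1))).

(** Jensen passes to the second moment, which [sum_sqr_draw] computes for the centered vectors [y];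
    centering does not increase the sum of squares. *)
Lemma draw_noise (R : realType) (d n b : nat) (z : 'I_n -> 'cV[R]_d) :
  (2 <= n)%N -> (0 < b <= n)%N ->
  uniform_expectation (draws n b)
    (fun B => enorm (b%:R^-1 *: \sum_(i in B) z i - mean z)) <=
  draw_factor R n b * Num.sqrt (n%:R^-1 * \sum_i enorm (z i) ^+ 2).
Proof.
move=> n_ge2 /andP[b_gt0 bn].
have bR : 0 < b%:R :> R by rewrite ltr0n.
have nR : 0 < n%:R :> R by rewrite ltr0n (ltn_trans _ n_ge2).
have n1R : 0 < n%:R - 1 :> R by rewrite subr_gt0 ltr1n.
have nbR : 0 <= n%:R - b%:R :> R by rewrite subr_ge0 ler_nat.
have D_gt0 := card_draws_gt0 bn.
pose y i := z i - mean z.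
have sum_z : \sum_i z i = n%:R *: mean z by rewrite scalerA mulfV ?scale1r ?gt_eqF.
have sum_y : \sum_i y i = 0.
  by rewrite sumrB sumr_const card_ord sum_z scaler_nat subrr.
have sqr_y : \sum_i dotv (y i) (y i) <= \sum_i enorm (z i) ^+ 2.
  have -> : \sum_i dotv (y i) (y i) =
      \sum_i enorm (z i) ^+ 2 - n%:R * dotv (mean z) (mean z).
    transitivity (\sum_i (enorm (z i) ^+ 2 - dotv (z i) (mean z) - dotv (mean z) (y i))).
      apply: eq_bigr => i _; rewrite sqr_enorm /y !dotv_linear; ring.
    rewrite !sumrB -dotv_suml -dotv_sumr sum_y dotv0 subr0 sum_z.
    by rewrite dotvZl.
  by rewrite gerBl mulr_ge0 ?dotv_ge0 // ltW.
rewrite /draw_factor -sqrtrM ?divr_ge0 ?mulr_ge0 ?(ltW n1R) //.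
set X := fun B => _.
have X_ge0 : 0 <= uniform_expectation (draws n b) X.
  by apply: uniform_expectation_ge0 => B; exact: enorm_ge0.
rewrite -[leLHS](ger0_norm X_ge0) -sqrtr_sqr ler_wsqrtr //.
apply: le_trans (uniform_expectation_sqr _ D_gt0) _.
have -> : uniform_expectation (draws n b) (fun B => X B ^+ 2) =
    (b%:R ^+ 2 * #|draws n b|%:R * (n%:R * (n%:R - 1)))^-1 *
    (n%:R * (n%:R - 1) *
    (\sum_(B in draws n b) dotv (\sum_(i in B) y i) (\sum_(i in B) y i))).
  have -> : uniform_expectation (draws n b) (fun B => X B ^+ 2) =
     uniform_expectation (draws n b) (fun B => b%:R ^- 2 *
       dotv (\sum_(i in B) y i) (\sum_(i in B) y i)).
    congr (_ * _); apply: eq_bigr => B; rewrite inE => /eqP Bb.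
    have -> : X B = enorm (b%:R^-1 *: \sum_(i in B) y i).
      rewrite /X sumrB sumr_const Bb scalerBr -[mean z *+ _]scaler_nat scalerA mulVf ?gt_eqF //.
      by rewrite scale1r.
    by rewrite sqr_enorm !dotv_linear mulrA -expr2 exprVn.
  rewrite uniform_expectationZ /uniform_expectation; field.
  by rewrite !gt_eqF // ltr0n.
rewrite sum_sqr_draw //.
have -> S : (b%:R ^+ 2 * #|draws n b|%:R * (n%:R * (n%:R - 1)))^-1 *
    (#|draws n b|%:R * b%:R * (n%:R - b%:R) * S) =
    (n%:R - b%:R) / (b%:R * (n%:R - 1)) * (n%:R^-1 * S) :> R.
  by field; rewrite !gt_eqF // ltr0n.
rewrite ler_wpM2l ?divr_ge0 ?mulr_ge0 ?(ltW n1R) //.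
by rewrite ler_wpM2l // invr_ge0 ltW.
Qed.

(** * Expectation over sequences of batches *)

Section BatchSequences.
Variables (R : realType) (n b : nat).
Implicit Types (X : seq {set 'I_n} -> R).

(** [X] is defined on sequences rather than tuples, so that one function can be averaged at every
    length. *)
Definition expect_batches (N : nat) X : R :=
  uniform_expectation (batch_seqs n b N) (fun Bs => X Bs).

Lemma sum_batch_seqsS N X :
  \sum_(Bs in batch_seqs n b N.+1) X Bs =
  \sum_(Bs in batch_seqs n b N) \sum_(B in draws n b) X (rcons Bs B).
Proof.
pose h (p : N.-tuple {set 'I_n} * {set 'I_n}) := [tuple of rcons p.1 p.2].
have h_inj : injective h.
  move=> [s B] [s' B'] /(congr1 val) /= /eqP; rewrite eqseq_rcons.
  by move=> /andP[/eqP ss /eqP ->]; congr (_, _); exact: val_inj.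
have h_bij : bijective h.
  apply: inj_card_bij h_inj _.
  by rewrite card_prod !card_tuple expnSr.
rewrite pair_big_dep (reindex h) /=; last exact: onW_bij.
by apply: eq_bigl => -[s B]; rewrite !inE /= all_rcons andbC.
Qed.

Lemma card_batch_seqsS N :
  #|batch_seqs n b N.+1|%:R = #|batch_seqs n b N|%:R * #|draws n b|%:R :> R.
Proof.
rewrite -[LHS]mulr1 mulr_natl -sumr_const (sum_batch_seqsS N (fun=> 1)).
by rewrite !sumr_const -[LHS]mulr_natl.
Qed.

(** The tower property: independence lets the last batch be averaged first, with the earlier ones
    fixed. *)
Lemma expect_batchesS N X : expect_batches N.+1 X =
  expect_batches N (fun Bs => uniform_expectation (draws n b) (fun B => X (rcons Bs B))).
Proof.
rewrite /expect_batches /uniform_expectation sum_batch_seqsS card_batch_seqsS.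
by rewrite invfM -mulrA -mulr_sumr.
Qed.

Hypothesis bn : (b <= n)%N.

Lemma card_batch_seqs_gt0 N : (0 < #|batch_seqs n b N|)%N.
Proof.
elim: N => [|N IHN].
  by apply/card_gt0P; exists [tuple]; rewrite inE.
by rewrite -(ltr0n R) card_batch_seqsS mulr_gt0 ?ltr0n ?card_draws_gt0.
Qed.

Lemma expect_batches0 X : expect_batches 0 X = X [::].
Proof.
rewrite -[RHS](uniform_expectation_cst _ (card_batch_seqs_gt0 0)).
by congr (_ * _); apply: eq_bigr => Bs _; rewrite tuple0.
Qed.

Lemma expect_batches_affine N X a c :
  expect_batches N (fun Bs => a * X Bs + c) = a * expect_batches N X + c.
Proof.
rewrite /expect_batches uniform_expectationD uniform_expectationZ.
by rewrite uniform_expectation_cst ?card_batch_seqs_gt0.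
Qed.

Lemma expect_batches_le N X Y : (forall Bs, size Bs = N -> X Bs <= Y Bs) ->
  expect_batches N X <= expect_batches N Y.
Proof. by move=> XY; apply: uniform_expectation_le => s _; rewrite XY ?size_tuple. Qed.

End BatchSequences.

(** * Stages of the algorithm *)

Lemma eq_shb (R : realType) (d : nat) (alpha beta : R)
    (G G' : nat -> 'cV[R]_d -> 'cV[R]_d) w k :
  (forall j, (j < k)%N -> G j =1 G' j) ->
  shb alpha beta G w k = shb alpha beta G' w k.
Proof.
elim: k => [//|k IHk] GG' /=; rewrite IHk => [|j jk]; last exact/GG'/ltnW.
by case: (shb _ _ _ _ _) => x xprev; rewrite GG'.
Qed.

Lemma eq_multistage_shb (R : realType) (d n : nat) (f : 'I_n -> 'cV[R]_d -> R)
    (L mu : R) (T b : nat) w0 (Bs Bs' : seq {set 'I_n}) i :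
  (forall j, (j < batch_offset (L / mu) T i)%N ->
    nth finset.set0 Bs j = nth finset.set0 Bs' j) ->
  multistage_shb f L mu T b w0 Bs i = multistage_shb f L mu T b w0 Bs' i.
Proof.
elim: i => [//|i IHi]; rewrite {1}/batch_offset big_ord_recr /= => BsBs'.
rewrite IHi => [|j ji]; last by apply/BsBs'/ltn_addr.
by congr (_.1); apply: eq_shb => j jT x; rewrite BsBs' // ltn_add2l.
Qed.

Lemma trmx_mean (R : realType) (d n : nat) (A : 'I_n -> 'M[R]_d) :
  (forall i, (A i)^T = A i) -> (mean A)^T = mean A.
Proof.
move=> A_sym; rewrite /mean linearZ linear_sum /=; congr (_ *: _).
by apply: eq_bigr => i _; rewrite A_sym.
Qed.

Section Stages.
Variables (R : realType) (d n : nat) (A : 'I_n -> 'M[R]_d) (c : 'I_n -> 'cV[R]_d).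
Variables (b : nat) (wstar : 'cV[R]_d) (L mu : R).
Let f i := quad (A i) (c i).
Let Am := mean A.
Let zeta := draw_factor R n b.
Let chi := grad_noise f wstar.
Hypothesis n_ge2 : (2 <= n)%N.
Hypothesis b_gt0 : (0 < b)%N.
Hypothesis bn : (b <= n)%N.
Hypothesis A_sym : forall i, (A i)^T = A i.
Hypothesis A_smooth : forall i x, dotv (A i *m x) (A i *m x) <= L ^+ 2 * dotv x x.
Hypothesis Am_ge : forall x, mu * dotv x x <= dotv x (Am *m x).
Hypothesis Am_le : forall x, dotv x (Am *m x) <= L * dotv x x.
Hypothesis wstar_min : Am *m wstar = mean c.
Hypotheses (mu_gt0 : 0 < mu) (mu_le_L : mu <= L).
Hypothesis zeta_le : 100 * (L / mu) * zeta <= 1.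

Let L_gt0 : 0 < L. Proof. exact: lt_le_trans mu_le_L. Qed.
Let zeta_ge0 : 0 <= zeta. Proof. exact: sqrtr_ge0. Qed.
Let chi_ge0 : 0 <= chi. Proof. exact: sqrtr_ge0. Qed.

(** Each gradient splits into [A i *m (x - wstar)] and the gradient at [wstar]. The first family has
    root mean square at most [L |x - wstar|]; the second has mean 0 and root mean square [chi]. *)
Lemma stoch_grad_noise x :
  uniform_expectation (draws n b)
    (fun B => enorm (stoch_grad f b B x - Am *m (x - wstar))) <=
  zeta * (L * enorm (x - wstar) + chi).
Proof.
pose z1 i := A i *m (x - wstar); pose z2 i := grad (f i) wstar.
have mean1 : mean z1 = Am *m (x - wstar).
  by rewrite /mean /Am /mean -scalemxAl mulmx_suml.
have mean2 : mean z2 = 0.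
  rewrite /mean (eq_bigr (fun i => A i *m wstar - c i)); last first.
    by move=> i _; rewrite /z2 grad_quad.
  by rewrite sumrB scalerBr -mulmx_suml scalemxAl [X in X - _]wstar_min subrr.
have split B : stoch_grad f b B x - Am *m (x - wstar) =
    (b%:R^-1 *: \sum_(i in B) z1 i - mean z1) +
    (b%:R^-1 *: \sum_(i in B) z2 i - mean z2).
  rewrite mean1 mean2 subr0 addrAC -scalerDr -big_split /=.
  congr (_ *: _ - _); apply: eq_bigr => i _.
  by rewrite /z1 /z2 !grad_quad // mulmxBr addrA subrK.
apply: le_trans (_ : uniform_expectation (draws n b) (fun B =>
    enorm (b%:R^-1 *: \sum_(i in B) z1 i - mean z1) +
    enorm (b%:R^-1 *: \sum_(i in B) z2 i - mean z2)) <= _).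
  by apply: uniform_expectation_le => B _; rewrite split enormD.
rewrite uniform_expectationD mulrDr lerD //; last first.
  by apply: draw_noise => //; rewrite b_gt0.
apply: le_trans (draw_noise z1 n_ge2 _) _; first by rewrite b_gt0.
rewrite ler_wpM2l // -(ger0_norm (mulr_ge0 (ltW L_gt0) (enorm_ge0 (x - wstar)))).
rewrite -sqrtr_sqr ler_wsqrtr // mulrC ler_pdivrMr ?ltr0n ?(ltn_trans _ n_ge2) //.
rewrite mulr_natr -[X in _ *+ X](card_ord n) -sumr_const ler_sum // => i _.
by rewrite exprMn !sqr_enorm A_smooth.
Qed.

Section Stage.
Variables (alpha : R).
Hypotheses (alpha_gt0 : 0 < alpha) (alpha_le : alpha * L <= 1).
Let s := Num.sqrt (alpha * mu).
Let beta := (1 - 2^-1 * s) ^+ 2.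

Let s_gt0 : 0 < s. Proof. by rewrite sqrtr_gt0 mulr_gt0. Qed.
Let sqr_s : s ^+ 2 = alpha * mu.
Proof. by rewrite sqr_sqrtr // mulr_ge0 // ltW. Qed.
Let s_le1 : s <= 1.
Proof.
rewrite -(@ler_sqr _ s 1) ?nnegrE ?(ltW s_gt0) // expr1n sqr_s.
by apply: le_trans alpha_le; rewrite ler_pM2l.
Qed.
Let Am_ge_s x : s ^+ 2 * dotv x x <= alpha * dotv x (Am *m x).
Proof. by rewrite sqr_s -mulrA ler_pM2l. Qed.
Let Am_le_s x : alpha * dotv x (Am *m x) <= dotv x x.
Proof.
apply: le_trans (_ : alpha * (L * dotv x x) <= _); first by rewrite ler_pM2l.
by rewrite mulrA ler_piMl ?dotv_ge0.
Qed.

Let N u v := hb_norm Am alpha s u v.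

(** The noiseless step contracts by [1 - s / 2]; the noise proportional to the error costs at most
    half of that gain, [s / 4]. *)
Lemma hb_norm_stoch_step x xprev :
  uniform_expectation (draws n b) (fun B =>
    N (x - alpha *: stoch_grad f b B x + beta *: (x - xprev) - wstar) (x - wstar))
  <= (1 - s / 4) * N (x - wstar) (xprev - wstar) + alpha * zeta * chi.
Proof.
set u := x - wstar; set v := xprev - wstar.
apply: le_trans (_ : uniform_expectation (draws n b) (fun B =>
    alpha * enorm (stoch_grad f b B x - Am *m u) + (1 - 2^-1 * s) * N u v) <= _).
  apply: uniform_expectation_le => B _; set g := stoch_grad f b B x.
  have -> : x - alpha *: g + beta *: (x - xprev) - wstar =
      u - alpha *: (Am *m u) + beta *: (u - v) + (- alpha) *: (g - Am *m u).
    by rewrite /u /v; apply/colP => i; rewrite !mxE; ring.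
  apply: le_trans (hb_norm_step s_gt0 s_le1 (trmx_mean A_sym) Am_ge_s Am_le_s _ _ _) _.
  by rewrite addrC enormZ normrN gtr0_norm.
rewrite uniform_expectationD uniform_expectationZ.
rewrite uniform_expectation_cst ?card_draws_gt0 //.
have /(ler_wpM2l (ltW alpha_gt0)) := stoch_grad_noise x; rewrite -/u.
have /(ler_wpM2l (mulr_ge0 (mulr_ge0 (ltW alpha_gt0) zeta_ge0) (ltW L_gt0))) :=
  enorm_le_hb_norm s_gt0 s_le1 (trmx_mean A_sym) Am_ge_s Am_le_s u v.
rewrite -/(N u v).
have N_ge0 : 0 <= N u v by exact: sqrtr_ge0.
(* As [s^2 = alpha mu], this amounts to [8 (L / mu) zeta <= 1], which [zeta_le] implies. *)
have small : alpha * zeta * L * (2 / s * N u v) <= s / 4 * N u v.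
  rewrite mulrA ler_wpM2r // mulrA ler_pdivrMr //.
  have -> : s / 4 * s = alpha * mu / 4 by rewrite mulrAC -expr2 sqr_s.
  have -> : alpha * zeta * L * 2 = alpha * mu * (zeta * (L / mu) * 2).
    by field; rewrite gt_eqF.
  rewrite ler_pM2l ?mulr_gt0 //.
  have := zeta_le; rewrite (mulrC zeta); lra.
move: small; set S := s / 4 * _; set e := uniform_expectation _ _.
set m := enorm u.
have -> : (1 - s / 4) * N u v = N u v - S by rewrite /S; ring.
have -> : (1 - 2^-1 * s) * N u v = N u v - 2 * S by rewrite /S; field.
lra.
Qed.

Variables (off : nat) (w : seq {set 'I_n} -> 'cV[R]_d).
Hypothesis w_rcons : forall Bs B, (off <= size Bs)%N -> w (rcons Bs B) = w Bs.

Let state Bs k := shb alpha beta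
  (fun j => stoch_grad f b (nth finset.set0 Bs (off + j))) (w Bs) k.

(** The appended batch sits at position [off + k]: it affects neither the starting point of the
    stage nor its first [k] steps. *)
Lemma state_rcons Bs B k : size Bs = (off + k)%N ->
  state (rcons Bs B) k.+1 =
    let: (x, xprev) := state Bs k in
    (x - alpha *: stoch_grad f b B x + beta *: (x - xprev), x).
Proof.
move=> sBs; rewrite /state /= w_rcons ?sBs ?leq_addr //.
rewrite nth_rcons sBs ltnn eqxx.
rewrite (_ : shb _ _ _ (w Bs) k = state Bs k) //.
by apply: eq_shb => j jk x; rewrite nth_rcons sBs ltn_add2l jk.
Qed.

Let err Bs k := N ((state Bs k).1 - wstar) ((state Bs k).2 - wstar).

Lemma stage_hb_norm k :
  expect_batches b (off + k) (fun Bs => err Bs k) <=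
  (1 - s / 4) ^+ k * (2 * expect_batches b off (fun Bs => enorm (w Bs - wstar)))
    + 4 * alpha * zeta * chi / s.
Proof.
(* This quantity is the fixed point of the one-step bound [E -> (1 - s / 4) E + alpha zeta chi]. *)
have noise_ge0 : 0 <= 4 * alpha * zeta * chi / s.
  by rewrite divr_ge0 ?mulr_ge0 // ltW.
elim: k => [|k IHk].
  rewrite addn0 expr0 mul1r.
  apply: le_trans (_ : expect_batches b off
    (fun Bs => 2 * enorm (w Bs - wstar) + 0) <= _); last first.
    by rewrite expect_batches_affine // addr0 lerDl.
  apply: expect_batches_le => Bs _; rewrite addr0.
  exact: (hb_norm_init s_gt0 s_le1 (trmx_mean A_sym) Am_ge_s Am_le_s).
rewrite addnS expect_batchesS.
apply: le_trans (_ : expect_batches b (off + k) (fun Bs =>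
    (1 - s / 4) * err Bs k + alpha * zeta * chi) <= _).
  apply: expect_batches_le => Bs sBs.
  apply: le_trans (hb_norm_stoch_step _ _).
  apply: uniform_expectation_le => B _; rewrite /err state_rcons //.
  by case: (state Bs k).
rewrite expect_batches_affine //.
have r_ge0 : 0 <= 1 - s / 4 by move: s_le1; lra.
apply: le_trans (lerD (ler_wpM2l r_ge0 IHk) (lexx _)) _.
rewrite exprS mulrDr mulrA -addrA lerD2l.
rewrite le_eqVlt; apply/orP; left; apply/eqP.
by field; rewrite gt_eqF.
Qed.

(** Returning to the Euclidean norm costs [2 / s]; since [s^2 = alpha mu], the noise term then no
    longer depends on the step size. *)
Lemma stage_enorm k :
  expect_batches b (off + k) (fun Bs => enorm ((state Bs k).1 - wstar)) <=
  4 / s * (1 - s / 4) ^+ k *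
    expect_batches b off (fun Bs => enorm (w Bs - wstar)) + 8 * zeta * chi / mu.
Proof.
apply: le_trans (_ : expect_batches b (off + k) (fun Bs => 2 / s * err Bs k + 0) <= _).
  apply: expect_batches_le => Bs _; rewrite addr0.
  exact: (enorm_le_hb_norm s_gt0 s_le1 (trmx_mean A_sym) Am_ge_s Am_le_s).
rewrite expect_batches_affine // addr0.
apply: le_trans (ler_wpM2l _ (stage_hb_norm k)) _; first by rewrite divr_ge0 // ltW.
rewrite mulrDr le_eqVlt; apply/orP; left; apply/eqP; congr (_ + _); first by ring.
have -> : 8 * zeta * chi / mu = 8 * alpha * zeta * chi / s ^+ 2.
  by rewrite sqr_s; field; rewrite !gt_eqF.
by field; rewrite gt_eqF.
Qed.

End Stage.
End Stages.

(** * Lambert function and stage schedule *)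

Section Schedule.
Variable R : realType.
Implicit Types (x y kappa q : R) (T i n b : nat).

(** The intermediate value theorem on [[0, x]] shows that the choice in [lambertW] does not fall
    back on its default value. *)
Lemma lambertW_spec x : 0 <= x -> 0 <= lambertW x /\ lambertW x * expR (lambertW x) = x.
Proof.
move=> x_ge0; have eqW : lambertW x * expR (lambertW x) = x.
  have [||y _ yP] := @IVT R (fun y => y * expR y) 0 x x x_ge0.
  - apply: continuous_subspaceT => y; apply: continuousM; first exact: cvg_id.
    exact: continuous_expR.
  - rewrite mul0r ge_min le_max x_ge0 /=.
    by rewrite ler_peMr ?orbT // -[leLHS]expR0 ler_expR.
  - exact: (@xgetPex R 0 [set y | y * expR y = x]%classic (ex_intro _ y yP)).
split=> //; rewrite leNgt; apply/negP => W_lt0.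
by move: x_ge0; rewrite leNgt -{1}eqW pmulr_llt0 ?expR_gt0 // W_lt0.
Qed.

Lemma ln_sqrt2 : 2 * ln (Num.sqrt 2) = ln 2 :> R.
Proof.
rewrite -[in RHS](sqr_sqrtr (ler0n R 2)) lnXn ?sqrtr_gt0 //.
by rewrite mulr_natl.
Qed.

Lemma ln2_ge_half : 2^-1 <= ln 2 :> R.
Proof.
have /le_ln1Dx : -1 < - 2^-1 :> R by lra.
rewrite (_ : 1 + _ = 2^-1 :> R); last by field.
by rewrite lnV ?posrE // lerN2.
Qed.

Lemma last_stage_bound : exists2 C : R, 0 <= C &
  forall kappa T, 1 < kappa -> (0 < T)%N ->
  (last_stage kappa T).+1%:R * Num.sqrt (stage_scale R (last_stage kappa T)) <=
    C * kappa * (1 + ln T%:R) ^+ 2 / Num.sqrt T%:R.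
Proof.
(* The product of 5 from [I_le], 2 from [scale_le] and [1536 = 4 * 384] from [eW]. *)
exists 15360 => [|kappa T kappa_gt1 T_gt0]; first exact: ler0n.
rewrite /last_stage.
set x := T%:R * _ / _; set W := lambertW x; set I := Num.truncn _.
set lam : R := ln (Num.sqrt 2) in x W I *.
have lam_ge : 4^-1 <= lam by have := ln_sqrt2; rewrite -/lam; have := ln2_ge_half; lra.
have lam_gt0 : 0 < lam by lra.
have T_ge1 : 1 <= T%:R :> R by rewrite ler1n.
have T_gt0' : 0 < T%:R :> R by lra.
set K := Num.sqrt kappa in x W I *.
have K_ge1 : 1 <= K by rewrite -[leLHS]sqrtr1 ler_wsqrtr // ltW.
have K_gt0 : 0 < K by lra.
have K_le : K <= kappa.
  by rewrite -(sqr_sqrtr (_ : 0 <= kappa)) ?ler_eXnr //; lra.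
have x_gt0 : 0 < x by rewrite divr_gt0 ?mulr_gt0.
have [W_ge0 WP] := lambertW_spec (ltW x_gt0); rewrite -/W in W_ge0 WP.
set l := 1 + ln T%:R.
have l_ge1 : 1 <= l by rewrite lerDl ln_ge0.
have W_le : W <= l.
  have [W_le1|W_gt1] := leP W 1; first exact: le_trans l_ge1.
  apply: le_trans (_ : ln T%:R <= _); last by rewrite lerDr.
  rewrite -ler_expR lnK ?posrE //; apply: le_trans (_ : x <= _).
    by rewrite -WP ler_peMl ?expR_ge0 // ltW.
  rewrite /x ler_pdivrMr ?mulr_gt0 // ler_pM2l //.
  have : lam <= 1.
    rewrite -ler_expR lnK ?posrE ?sqrtr_gt0 //.
    apply: le_trans (_ : 2 <= _); last by have := expR_ge1Dx (1 : R); lra.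
    by rewrite -ler_sqr ?nnegrE ?sqrtr_ge0 // sqr_sqrtr //; lra.
  lra.
have I_le : I.+1%:R <= 5 * l.
  have : I%:R <= W / lam by rewrite /I -/W mulrC truncn_le divr_ge0 // ltW.
  have : W / lam <= 4 * l.
    by rewrite ler_pdivrMr //; nra.
  by rewrite -natr1; lra.
(* As [W / lam < I + 1] and [exp (2 lam) = 2], one gets [exp (2 W) <= 2^(I + 1)]; the factor 2
   absorbs the rounding of [I]. *)
have scale_le : Num.sqrt (stage_scale R I) <= 2 * expR (- W).
  rewrite -ler_sqr ?nnegrE ?sqrtr_ge0 ?mulr_ge0 ?expR_ge0 //.
  rewrite sqr_sqrtr ?invr_ge0 ?exprn_ge0 // exprMn -expRM_natl mulrN expRN.
  rewrite /stage_scale -[leLHS]mul1r ler_pdivrMr ?exprn_gt0 //.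
  rewrite mulrAC ler_pdivlMr ?expR_gt0 // mul1r.
  have : W / lam < I.+1%:R by rewrite mulrC; exact: truncnS_gt.
  rewrite ltr_pdivrMr // => WI.
  have : expR (2%:R * W) <= 2 ^+ I.+1.
    apply: le_trans (_ : expR (I.+1%:R * (2 * lam)) <= _).
      by rewrite ler_expR; lra.
    by rewrite ln_sqrt2 expRM_natl lnK ?posrE.
  move=> /le_trans; apply; rewrite exprS ler_wpM2r ?exprn_ge0 //.
  by rewrite expr2 ler_peMr // ler1n.
(* The equation for [W] reads [exp (- W) = W / x]; then [W <= l] and [4 lam >= 1]. *)
have eW : expR (- W) <= 1536 * K * l / T%:R.
  rewrite -(ler_pM2r x_gt0) -[X in _ * X <= _]WP mulrCA -expRD addNr expR0 mulr1.
  have -> : 1536 * K * l / T%:R * x = 4 * lam * l.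
    by rewrite /x; field; rewrite !gt_eqF.
  by apply: le_trans W_le _; rewrite ler_peMl //; lra.
have sqrtT : Num.sqrt T%:R <= T%:R :> R.
  by rewrite -[leRHS]ger0_norm // -sqrtr_sqr ler_wsqrtr // ler_eXnr.
have sqrtT_gt0 : 0 < Num.sqrt T%:R :> R by rewrite sqrtr_gt0.
apply: le_trans (ler_pM _ _ I_le (le_trans scale_le (ler_wpM2l _ eW))) _ => //.
have -> : 5 * l * (2 * (1536 * K * l / T%:R)) = 15360 * l ^+ 2 * (K / T%:R).
  by field; rewrite gt_eqF.
have -> (a y z : R) : a * kappa * y / z = a * y * (kappa / z) by ring.
apply: ler_wpM2l; first by rewrite mulr_ge0 ?ler0n ?sqr_ge0.
by rewrite ler_pM ?invr_ge0 ?lef_pV2 ?posrE // ltW.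
Qed.

(** Both sides amount to [n <= b (1 + (n - 1) q)]. *)
Lemma draw_factor_le n b q : (2 <= n)%N -> (0 < b)%N -> 0 <= q ->
  n%:R * (1 / (1 + (n%:R - 1) * q)) <= b%:R -> draw_factor R n b <= Num.sqrt q.
Proof.
move=> n_ge2 b_gt0 q_ge0.
have n1 : 0 < n%:R - 1 :> R by rewrite subr_gt0 ltr1n.
have D_gt0 : 0 < 1 + (n%:R - 1) * q by rewrite ltr_pwDl // mulr_ge0 // ltW.
rewrite mulrA mulr1 ler_pdivrMr // => nb.
rewrite /draw_factor ler_wsqrtr // ler_pdivrMr ?mulr_gt0 ?ltr0n //.
by rewrite lerBlDl; move: nb; congr (_ <= _); ring.
Qed.

(** The first batch bound yields the factor 100 because [100^2 <= 3^5 * 2^6 = 15552]; the second is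
    used with [q = a_I / 3 <= a_I]. *)
Lemma min_batch_draw_factor n b kappa T : (2 <= n)%N -> 1 < kappa ->
  min_batch n kappa T <= b%:R ->
  [/\ (0 < b)%N, 100 * kappa * draw_factor R n b <= 1 &
      draw_factor R n b <= Num.sqrt (stage_scale R (last_stage kappa T))].
Proof.
move=> n_ge2 kappa_gt1; rewrite /min_batch; set I := last_stage kappa T.
set q2 := (X in Num.max _ X).
have n1 : 0 < n%:R - 1 :> R by rewrite subr_gt0 ltr1n.
have n0 : 0 < n%:R :> R by rewrite ltr0n (ltn_trans _ n_ge2).
rewrite (maxr_pMr _ _ (ltW n0)) ge_max => /andP[nb1 nb2].
have kappa_gt0 : 0 < kappa by apply: lt_trans kappa_gt1.
have scale_gt0 : 0 < stage_scale R I by rewrite invr_gt0 exprn_gt0.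
have b_gt0 : (0 < b)%N.
  rewrite -(ltr0n R); apply: lt_le_trans nb2.
  by rewrite mulr_gt0 // divr_gt0 // ltr_pwDl // divr_ge0 ?mulr_ge0 // ltW.
split=> //.
- have C_gt0 : 0 < 3 ^+ 5 * 2 ^+ 6 :> R by rewrite mulr_gt0 ?exprn_gt0.
  have := @draw_factor_le n b ((100 * kappa) ^- 2) n_ge2 b_gt0.
  rewrite invr_ge0 exprn_ge0 ?mulr_ge0 ?(ltW kappa_gt0) // => /(_ isT) H.
  rewrite mulrC -ler_pdivlMr ?mulr_gt0 // mul1r.
  rewrite -[leRHS]ger0_norm ?invr_ge0 ?mulr_ge0 ?(ltW kappa_gt0) //.
  rewrite -sqrtr_sqr exprVn; apply: H; apply: le_trans nb1.
  rewrite ler_pM2l // !mul1r lef_pV2 ?posrE.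
  + rewrite lerD2l ler_pM2l // exprMn lef_pV2 ?posrE ?mulr_gt0 ?exprn_gt0 //.
    by rewrite ler_pM2r ?exprn_gt0 //; lra.
  + by rewrite ltr_pwDl // divr_ge0 ?mulr_ge0 ?exprn_ge0 // ltW.
  + by rewrite ltr_pwDl // mulr_ge0 ?invr_ge0 ?exprn_ge0 ?mulr_ge0 // ltW.
- apply: le_trans (@draw_factor_le n b (stage_scale R I / 3) n_ge2 b_gt0 _ _) (ler_wsqrtr _).
  + by rewrite divr_ge0 // ltW.
  + by move: nb2; rewrite /q2 -!mulrA.
  + by rewrite ler_pdivrMr // ler_peMr ?ltW ?ltr1n.
Qed.

Lemma stage_budget_le_length kappa T i :
  stage_budget kappa T i <= (stage_length kappa T i)%:R.
Proof.
apply: le_trans (ceil_ge _) _; rewrite /stage_length natr_absz.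
by rewrite ler_int ler_norm.
Qed.

Lemma one_sub_expn_le x k : x <= 1 -> (1 - x) ^+ k <= expR (- (x * k%:R)).
Proof.
move=> x_le1; rewrite -mulNr expRM_natr lerXn2r ?nnegrE ?expR_ge0 ?subr_ge0 //.
exact: expR_ge1Dx.
Qed.

(** Here [1 / s = sqrt kappa <= kappa], and at least [T / 2] steps, each gaining [s / 4] in the
    exponent, give [T / (8 sqrt kappa)]. *)
Lemma first_stage_contraction kappa T (s : R) : 1 < kappa ->
  s = Num.sqrt (stage_scale R 0 / kappa) ->
  4 / s * (1 - s / 4) ^+ stage_length kappa T 0 <=
    4 * kappa * expR (- (T%:R / (8 * Num.sqrt kappa))).
Proof.
move=> kappa_gt1; have kappa_gt0 : 0 < kappa by apply: lt_trans kappa_gt1.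
rewrite /stage_scale expr0 invr1 mul1r sqrtrV ?(ltW kappa_gt0) //.
set K := Num.sqrt kappa => ->; rewrite invrK.
have K_ge1 : 1 <= K by rewrite -[leLHS]sqrtr1 ler_wsqrtr // ltW.
have K_gt0 : 0 < K by lra.
have K_le : K <= kappa.
  by rewrite -(sqr_sqrtr (_ : 0 <= kappa)) ?ler_eXnr //; lra.
have Ki_le1 : K^-1 <= 1 by rewrite invf_le1.
apply: ler_pM; [lra| by rewrite exprn_ge0 //; lra| lra|].
apply: le_trans (one_sub_expn_le _ _) _; first lra.
rewrite ler_expR lerN2.
have := stage_budget_le_length kappa T 0; rewrite /stage_budget /=.
move=> /(ler_wpM2l (_ : 0 <= K^-1 / 4)) H; apply: le_trans (H _).
  by rewrite le_eqVlt; apply/orP; left; apply/eqP; field; rewrite gt_eqF.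
by rewrite divr_ge0 ?invr_ge0 // ltW.
Qed.

(** With [1 / s = h K], the stage is long enough that the power is at most [1 / (32 h K)], which
    outweighs the prefactor [4 h K]. *)
Lemma later_stage_contraction kappa T i (s : R) : 1 < kappa ->
  s = Num.sqrt (stage_scale R i.+1 / kappa) ->
  4 / s * (1 - s / 4) ^+ stage_length kappa T i.+1 <= 1.
Proof.
move=> kappa_gt1; have kappa_gt0 : 0 < kappa by apply: lt_trans kappa_gt1.
have := stage_budget_le_length kappa T i.+1; rewrite /stage_budget.
rewrite (_ : i.+1 == 0%N = false) // => /(le_trans (ceil_ge _)).
set K := Num.sqrt kappa; set h := 2 `^ (i.+1%:R / 2).
set m := (stage_length _ _ _)%:R; set e := (X in _ * X <= _).
have K_ge1 : 1 <= K by rewrite -[leLHS]sqrtr1 ler_wsqrtr // ltW.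
have K_gt0 : 0 < K by lra.
have h_gt0 : 0 < h by rewrite powR_gt0.
have h_ge1 : 1 <= h by rewrite -(powRr0 2) ler_powR ?ler1n ?divr_ge0.
move=> budget ->.
have -> : Num.sqrt (stage_scale R i.+1 / kappa) = (h * K)^-1.
  have -> : stage_scale R i.+1 / kappa = ((h * K)^-1) ^+ 2.
    rewrite exprVn exprMn sqr_sqrtr ?(ltW kappa_gt0) // invfM; congr (_^-1 * _).
    by rewrite -[RHS]powR_mulrn ?powR_ge0 // -powRrM divfK ?powR_mulrn // pnatr_eq0.
  by rewrite sqrtr_sqr ger0_norm // invr_ge0 mulr_ge0 // ltW.
(* The 32 comes from the summand [5 ln 2] of the stage length. *)
have expRe : expR e = h * 32 * K.
  rewrite /e mulrDl !expRD lnK ?posrE //; congr (_ * _ * _).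
    by rewrite /h /powR pnatr_eq0 /= .
  by rewrite expRM_natl lnK ?posrE //; lra.
have hK_gt0 : 0 < h * K by rewrite mulr_gt0.
have e_ge0 : 0 <= e by rewrite -ler_expR expR0 expRe; nra.
have e_le : e <= (h * K)^-1 / 4 * m.
  rewrite -ler_pdivrMl ?divr_gt0 ?invr_gt0 //; apply: le_trans budget.
  rewrite ler_wpM2r // invf_div invrK.
  (* Hence [0 < 2 - sqrt 2 <= 1], and dividing by it only lengthens the stage. *)
  have s2 : 1 <= Num.sqrt (2 : R) < 2.
    rewrite -{1}(sqrtr1 R) ler_wsqrtr //=; last lra.
    rewrite -[ltRHS]ger0_norm // -sqrtr_sqr ltr_sqrt ?exprn_gt0 //; lra.
  case/andP: s2 => s2_ge1 s2_lt2.
  rewrite ler_pdivlMr ?subr_gt0 //.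
  rewrite -!mulrA ler_pM2l //; nra.
have hKi_le1 : (h * K)^-1 <= 1 by rewrite invf_le1 // mulr_ege1.
have hKi_ge0 : 0 <= (h * K)^-1 by rewrite invr_ge0 ltW.
apply: le_trans (ler_wpM2l _ (one_sub_expn_le _ _)) _; [by rewrite divr_ge0|lra|].
rewrite invrK; apply: le_trans (ler_wpM2l _ (_ : _ <= expR (- e))) _.
- by rewrite mulr_ge0 // ltW.
- by rewrite ler_expR lerN2.
- rewrite expRN expRe ler_pdivrMr ?mulr_gt0 //; nra.
Qed.

End Schedule.

(** * Smoothness, mean and minimizer of the finite sum *)

Section FiniteSum.
Variables (R : realType) (d n : nat) (A : 'I_n -> 'M[R]_d) (c : 'I_n -> 'cV[R]_d).
Let f i := quad (A i) (c i).
Let L := smoothness A.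
Let mu := strong_convexity A.
Hypothesis A_psd : forall i, symmetric_psd (A i).

Let A_sym i : (A i)^T = A i. Proof. by have [] := A_psd i. Qed.

Lemma smoothness_ge0 : 0 <= L.
Proof. exact: bigmax_ge_id. Qed.

Lemma smoothness_rayleigh i x : dotv x (A i *m x) <= L * dotv x x.
Proof.
have [AT _] := A_psd i; apply: le_trans (lambda_max_rayleigh x AT) _.
by rewrite ler_wpM2r ?dotv_ge0 // (le_bigmax _ (fun i => lambda_max (A i))).
Qed.

Lemma smoothness_mulmx i x : dotv (A i *m x) (A i *m x) <= L ^+ 2 * dotv x x.
Proof.
have Ax := sqr_psd_mulmx_le x (A_psd i) (smoothness_rayleigh i).
apply: le_trans Ax _; rewrite expr2 -mulrA.
by rewrite ler_wpM2l ?smoothness_ge0 ?smoothness_rayleigh.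
Qed.

Lemma mean_form x : dotv x (mean A *m x) = n%:R^-1 * \sum_i dotv x (A i *m x).
Proof. by rewrite /mean -scalemxAl dotvZr mulmx_suml dotv_sumr. Qed.

Lemma smoothness_mean x : (0 < n)%N -> dotv x (mean A *m x) <= L * dotv x x.
Proof.
move=> n_gt0; rewrite mean_form mulrC ler_pdivrMr ?ltr0n //.
rewrite mulr_natr -[X in _ *+ X](card_ord n) -sumr_const ler_sum // => i _.
exact: smoothness_rayleigh.
Qed.

Lemma finite_sum_quad w : finite_sum f w = quad (mean A) (mean c) w.
Proof.
rewrite /finite_sum /quad mean_form /mean dotvZl dotv_suml sumrB -mulr_sumr.
by rewrite mulrBr mulrCA.
Qed.

Lemma finite_sum_min wstar : (forall w, finite_sum f wstar <= finite_sum f w) ->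
  mean A *m wstar = mean c.
Proof.
move=> wmin; apply/eqP; rewrite -subr_eq0; apply/eqP.
by apply: quad_min_grad (trmx_mean A_sym) _ => y; rewrite -!finite_sum_quad.
Qed.

End FiniteSum.

Theorem theorem4 (R : realType) :
  exists (C7 : R -> R -> R) (C8 : R -> R -> R -> R),
    (exists p q : nat, poly_polylog p q C7) /\
    (exists p q : nat, forall mu : R, 0 < mu -> poly_polylog p q (C8 mu)) /\
    forall (d n : nat) (A : 'I_n -> 'M[R]_d) (c : 'I_n -> 'cV[R]_d)
           (T b : nat) (w0 wstar : 'cV[R]_d),
      let f := fun i => quad (A i) (c i) in
      let L := smoothness A in
      let mu := strong_convexity A in
      let kappa := L / mu in
      (2 <= n)%N ->
      (forall i, symmetric_psd (A i)) ->
      (forall i, exists m : R, forall w, m <= f i w) ->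
      0 < mu ->
      1 < kappa ->
      (forall w, finite_sum f wstar <= finite_sum f w) ->
      min_budget kappa <= T%:R ->
      (b <= n)%N ->
      min_batch n kappa T <= b%:R ->
      shb_output_error f L mu T b w0 wstar <=
        C7 kappa T%:R * expR (- (T%:R / (8 * Num.sqrt kappa))) *
          enorm (w0 - wstar)
        + C8 mu kappa T%:R * (grad_noise f wstar / Num.sqrt T%:R).
Proof.
have [C C_ge0 last_stage_le] := last_stage_bound R.
(* [C7] is the prefactor of the first stage; in [C8], [8 / mu] is the noise level of one stage and
   the rest comes from [last_stage_bound]. *)
exists (fun kappa _ => 4 * kappa).
exists (fun mu kappa t => 8 / mu * (C * kappa * (1 + ln t) ^+ 2)).
split; [|split].
- exists 1%N, 0%N, 4 => kappa t kappa_gt1 _.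
  by rewrite expr0 mulr1 expr1 ger0_norm // mulr_ge0 // ltW // (lt_trans _ kappa_gt1).
- exists 1%N, 2%N => mu mu_gt0; exists (8 / mu * C) => kappa t kappa_gt1 t_ge1.
  have kappa_ge0 : 0 <= kappa by rewrite ltW // (lt_trans _ kappa_gt1).
  have muV_ge0 : 0 <= 8 / mu by rewrite divr_ge0 // ltW.
  rewrite expr1 !mulrA ger0_norm // -!mulrA.
  by rewrite mulrA mulr_ge0 // !mulr_ge0 // addr_ge0 ?ln_ge0.
move=> d n A c T b w0 wstar f L mu kappa n_ge2 A_psd _ mu_gt0 kappa_gt1 wmin budget bn batch.
have [b_gt0 zeta_kappa zeta_scale] := min_batch_draw_factor n_ge2 kappa_gt1 batch.
have kappa_gt0 : 0 < kappa by apply: lt_trans kappa_gt1.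
have mu_le_L : mu <= L.
  by move: kappa_gt1; rewrite /kappa ltr_pdivlMr // mul1r => /ltW.
have L_gt0 : 0 < L by apply: lt_le_trans mu_le_L.
have T_gt0 : (0 < T)%N.
  rewrite -(ltr0n R); apply: lt_le_trans budget; rewrite /min_budget.
  rewrite mulr_gt0 ?divr_gt0 ?mulr_gt0 ?exprn_gt0 ?sqrtr_gt0 ?ln_gt0 ?ltr1n //.
  by rewrite lt_max mulr_gt0.
set chi := grad_noise f wstar; set zeta := draw_factor R n b in zeta_kappa zeta_scale *.
have A_sym i : (A i)^T = A i by have [] := A_psd i.
have n_gt0 : (0 < n)%N by apply: ltn_trans n_ge2.
pose w Bs i := multistage_shb f L mu T b w0 Bs i.
pose e i := expect_batches b (batch_offset kappa T i) (fun Bs => enorm (w Bs i - wstar)).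
pose s i := Num.sqrt (stage_scale R i / kappa).
pose q i := 4 / s i * (1 - s i / 4) ^+ stage_length kappa T i.
have e_ge0 i : 0 <= e i.
  by apply: uniform_expectation_ge0 => Bs; exact: enorm_ge0.
have stage i : e i.+1 <= q i * e i + 8 * zeta * chi / mu.
  have alpha_mu : stage_scale R i / L * mu = stage_scale R i / kappa.
    by rewrite /kappa; field; rewrite !gt_eqF.
  have scale_gt0 : 0 < stage_scale R i by rewrite invr_gt0 exprn_gt0.
  have alpha_gt0 : 0 < stage_scale R i / L by rewrite divr_gt0.
  have alpha_le : stage_scale R i / L * L <= 1.
    by rewrite divfK ?gt_eqF // invf_le1 ?exprn_gt0 // exprn_ege1 // ler1n.
  have w_rcons Bs B : (batch_offset kappa T i <= size Bs)%N -> w (rcons Bs B) i = w Bs i.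
    move=> sBs; apply: eq_multistage_shb => j ji.
    by rewrite nth_rcons (leq_trans ji sBs).
  have := stage_enorm n_ge2 b_gt0 bn A_sym (smoothness_mulmx A_psd)
    (fun x => lambda_min_rayleigh x (trmx_mean A_sym))
    (fun x => smoothness_mean A_psd x n_gt0) (finite_sum_min A_psd wmin)
    mu_gt0 mu_le_L zeta_kappa alpha_gt0 alpha_le w_rcons (stage_length kappa T i).
  rewrite alpha_mu -/(s i) => H.
  rewrite /e /batch_offset big_ord_recr /=; apply: le_trans H.
  by rewrite /w /= alpha_mu.
have e0 : e 0%N = enorm (w0 - wstar).
  by rewrite /e /batch_offset big_ord0 expect_batches0.
(* Stages after the first do not amplify the error, so each merely adds one more noise term. *)
have stages i : e i.+1 <= q 0%N * e 0%N + i.+1%:R * (8 * zeta * chi / mu).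
  elim: i => [|i IHi]; first by rewrite mul1r.
  apply: le_trans (stage i.+1) _.
  have -> (x : R) : i.+2%:R * x = i.+1%:R * x + x by rewrite -[i.+2%:R]natr1; ring.
  rewrite [leRHS]addrA lerD2r.
  apply: le_trans IHi; rewrite ler_piMl //.
  exact: later_stage_contraction.
apply: le_trans (stages (last_stage kappa T)) _.
rewrite e0; apply: lerD.
  by rewrite ler_wpM2r ?enorm_ge0 //; exact: first_stage_contraction.
set I := last_stage kappa T.
have chi_ge0 : 0 <= chi by exact: sqrtr_ge0.
(* Replacing [zeta] by [sqrt a_I] puts the accumulated noise in the form bounded by
   [last_stage_bound]. *)
apply: le_trans (_ : 8 / mu * chi * (I.+1%:R * Num.sqrt (stage_scale R I)) <= _).
  rewrite (_ : I.+1%:R * _ = 8 / mu * chi * (I.+1%:R * zeta)); last by ring.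
  by rewrite !ler_wpM2l // mulr_ge0 // divr_ge0 // ltW.
have := ler_wpM2l (mulr_ge0 (divr_ge0 (ler0n R 8) (ltW mu_gt0)) chi_ge0)
  (last_stage_le _ _ kappa_gt1 T_gt0).
by move/le_trans; apply; rewrite le_eqVlt; apply/orP; left; apply/eqP; ring.
Qed.
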